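(* Let $r\ge2$. Any linear $r$-graph that contains a loose triangle (as a subgraph) is not Sidorenko.
   Context: An $r$-graph is a finite $r$-uniform hypergraph; it is linear if any two distinct edges share at most one vertex. The $r$-uniform loose triangle is the $r$-graph with vertex set $\{1,2,\dots,3r-3\}$ and edges $\{1,2,\dots,r\}$, $\{r,r+1,\dots,2r-1\}$, $\{2r-1,\dots,3r-3,1\}$. For a symmetric measurable $W:[0,1]^r\to[0,1]$ (an $r$-graphon), $t_H(W)=\int_{[0,1]^{V(H)}}\prod_{\{u_1,\dots,u_r\}\in E(H)}W(x_{u_1},\dots,x_{u_r})\,dx$. $H$ is Sidorenko if $t_H(W)\ge(\int_{[0,1]^r}W)^{\mathrm{e}(H)}$ for every $r$-graphon $W$, where $\mathrm{e}(H)$ is the number of edges. *)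

(* Defs.v *)
From HB Require Import structures.
From mathcomp Require Import all_boot all_order all_algebra all_fingroup.
From mathcomp Require Import zify.
From mathcomp Require Import all_classical all_reals all_analysis.

Set Implicit Arguments.
Unset Strict Implicit.
Unset Printing Implicit Defensive.

Import Order.TTheory GRing.Theory Num.Theory.
Import numFieldNormedType.Exports.

Local Open Scope ring_scope.

Record r_graph (r : nat) := MkRGraph {
  vertex : finType;
  edges : {set {set vertex}};
  edges_uniform : forall e, e \in edges -> #|e| = r
}.

Definition linear_r_graph r (H : r_graph r) : Prop :=
  forall e f : {set vertex H}, e \in edges H -> f \in edges H ->
  e != f -> (#|e :&: f| <= 1)%N.

(* F is a subgraph of H up to isomorphism; not necessarily an induced one. *)
Definition contains r (H F : r_graph r) : Prop :=
  exists f : vertex F -> vertex H, injective f /\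
    forall e : {set vertex F}, e \in edges F -> f @: e \in edges H.

(* The vertex 1 <= k <= 3r - 3 is represented by the ordinal k - 1. *)
Definition loose_triangle_edges (r : nat) : {set {set 'I_(3 * r - 3)}} :=
  [set [set i : 'I_(3 * r - 3) | (i.+1 <= r)%N];
       [set i : 'I_(3 * r - 3) | (r <= i.+1 <= 2 * r - 1)%N];
       [set i : 'I_(3 * r - 3) | (2 * r - 1 <= i.+1)%N || (i.+1 == 1)%N]].

Lemma card_ord_itv (n a b : nat) : (b <= n)%N ->
  #|[set i : 'I_n | (a <= i < b)%N]| = (b - a)%N.
Proof.
move=> bn; suff -> : #|[set i : 'I_n | (a <= i < b)%N]| =
    (minn b n - minn a n)%N by lia.
rewrite cardsE -sum1_card big_mkcond /= {bn}.
elim: n => [|n IHn]; first by rewrite big_ord0; lia.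
rewrite big_ord_recr /= IHn unfold_in /=; case: ifPn; lia.
Qed.

Lemma loose_triangle_uniform r : (2 <= r)%N ->
  forall e, e \in loose_triangle_edges r -> #|e| = r.
Proof.
move=> r2 e; rewrite !inE -orbA => /or3P[] /eqP->.
- rewrite -[RHS]subn0 -(@card_ord_itv (3 * r - 3) 0 r); last by lia.
  by apply: eq_card => i; rewrite !inE.
- transitivity ((2 * r - 1) - (r - 1))%N; last by lia.
  rewrite -(@card_ord_itv (3 * r - 3) (r - 1) (2 * r - 1)); last by lia.
  by apply: eq_card => i; rewrite !inE; lia.
- have lt0 : (0 < 3 * r - 3)%N by lia.
  rewrite (_ : [set _ | _] = Ordinal lt0 |:
      [set i : 'I_(3 * r - 3) | (2 * r - 2 <= i < 3 * r - 3)%N]).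
    by rewrite cardsU1 card_ord_itv // !inE /=; lia.
  apply/setP => i; rewrite !inE -val_eqE /=; have := ltn_ord i; lia.
Qed.

Definition loose_triangle r (r2 : (2 <= r)%N) : r_graph r :=
  MkRGraph (loose_triangle_uniform r2).

Local Open Scope classical_set_scope.

Section cons_measure.
Context d (T : measurableType d) (R : realType) (n : nat).
Variables (mu : {sigma_finite_measure set T -> \bar R})
  (nu : {sigma_finite_measure set (n.-tuple T) -> \bar R}).

Definition pair_cons (p : T * n.-tuple T) : n.+1.-tuple T :=
  [tuple of p.1 :: p.2].

Lemma measurable_pair_cons : measurable_fun [set: T * n.-tuple T] pair_cons.
Proof. exact: (measurable_cons measurable_fst measurable_snd). Qed.

Definition cons_measure : set (n.+1.-tuple T) -> \bar R :=
  pushforward (mu \x nu)%E pair_cons.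

Let cons_measure0 : cons_measure set0 = 0%E.
Proof. by rewrite /cons_measure /pushforward preimage_set0 measure0. Qed.

Let cons_measure_ge0 A : (0 <= cons_measure A)%E.
Proof. by have mf := measurable_pair_cons; exact: measure_ge0. Qed.

Let cons_measure_sigma_additive : semi_sigma_additive cons_measure.
Proof.
by have mf := measurable_pair_cons; exact: measure_semi_sigma_additive.
Qed.

HB.instance Definition _ := isMeasure.Build _ _ _ cons_measure
  cons_measure0 cons_measure_ge0 cons_measure_sigma_additive.

Let cons_measure_sigma_finite : sigma_finite setT cons_measure.
Proof.
have /sigma_finiteP[F [TF ndF Ffin]] := sigma_finiteT mu.
have /sigma_finiteP[G [TG ndG Gfin]] := sigma_finiteT nu.
pose uncons (t : n.+1.-tuple T) : T * n.-tuple T :=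
  (thead t, [tuple of behead t]).
have munc : measurable_fun [set: n.+1.-tuple T] uncons.
  apply/measurable_fun_pair; first exact: measurable_tnth.
  exact: measurable_behead.
have unconsK p : uncons (pair_cons p) = p.
  case: p => x t; congr pair => //; exact/val_inj.
exists (fun i => uncons @^-1` (F i `*` G i)).
  rewrite -preimage_bigcup -(preimage_setT uncons); congr (_ @^-1` _).
  apply/esym; rewrite -subTset => -[x y] _.
  have [k _ Fx] : (\bigcup_i F i) x by rewrite -TF.
  have [l _ Gy] : (\bigcup_i G i) y by rewrite -TG.
  exists (maxn k l) => //; split => /=.
    by move: x Fx; exact/subsetPset/ndF/leq_maxl.
  by move: y Gy; exact/subsetPset/ndG/leq_maxr.
move=> i; have [mF Foo] := Ffin i; have [mG Goo] := Gfin i; split.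
  by rewrite -[X in measurable X]setTI; apply: munc => //; exact: measurableX.
rewrite /cons_measure /pushforward -comp_preimage.
rewrite (_ : uncons \o pair_cons = id); last exact/funext/unconsK.
by rewrite preimage_id product_measure1E// lte_mul_pinfty// ge0_fin_numE.
Qed.

HB.instance Definition _ := Measure_isSigmaFinite.Build _ _ _ cons_measure
  cons_measure_sigma_finite.

End cons_measure.

Fixpoint power_measure d (T : measurableType d) (R : realType)
    (mu : {sigma_finite_measure set T -> \bar R}) (n : nat) :
    {sigma_finite_measure set (n.-tuple T) -> \bar R} :=
  match n with
  | 0 => \d_([tuple] : 0.-tuple T)
  | n'.+1 => cons_measure mu (power_measure mu n')
  end.

Definition lebesgue_tuple (R : realType) (n : nat) :
    {sigma_finite_measure set (n.-tuple (measurableTypeR R)) -> \bar R} :=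
  power_measure (@lebesgue_measure R) n.

(* lebesgue_tuple R n is thus n-dimensional Lebesgue measure. *)
Lemma lebesgue_tuple_box (R : realType) (n : nat)
    (A : 'I_n -> set (measurableTypeR R)) :
  (forall i, measurable (A i)) ->
  measurable [set x : n.-tuple (measurableTypeR R) |
    forall i, A i (tnth x i)] /\
  lebesgue_tuple R n [set x | forall i, A i (tnth x i)] =
    (\prod_(i < n) lebesgue_measure (A i))%E.
Proof.
elim: n A => [|n IH] A mA.
  rewrite (_ : [set _ | _] = setT) ?big_ord0; last by apply/seteqP; split => // x _ [].
  by split => //; rewrite /lebesgue_tuple /= diracT.
have [mB EB] := IH (fun i => A (lift ord0 i)) (fun i => mA _).
split.
  rewrite (_ : [set _ | _] =
      \bigcap_(i in [set` 'I_n.+1]) ((fun x => tnth x i) @^-1` A i)).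
    apply: fin_bigcap_measurable => // i _.
    by rewrite -[X in measurable X]setTI; exact: measurable_tnth.
  by apply/seteqP; split => x /= h i; [move=> _|]; apply: h.
rewrite big_ord_recl -EB /= /cons_measure /pushforward.
rewrite -product_measure1E//; congr ((_ \x _)%E _).
apply/seteqP; split => -[x y] /=.
  move=> h; split => [|i]; first exact: (h ord0).
  by have := h (lift ord0 i); rewrite tnthS.
by move=> [h0 h] i; case: (unliftP ord0 i) => [j|] ->; rewrite ?tnthS //; exact: h.
Qed.

Definition unit_cube (R : realType) (n : nat) :
    set (n.-tuple (measurableTypeR R)) :=
  [set x | forall i, 0 <= (tnth x i : R) <= 1].
Arguments unit_cube R n : clear implicits.

Lemma measurable_unit_cube (R : realType) (n : nat) :
  measurable (unit_cube R n).
Proof.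
have [+ _] := @lebesgue_tuple_box R n (fun=> `[0, 1]) (fun=> measurable_itv _).
by congr measurable; apply/seteqP; split=> x h i; have := h i; rewrite /= in_itv.
Qed.

Section sidorenko.
Context (R : realType) (r : nat).

Definition graphon (W : r.-tuple (measurableTypeR R) -> R) : Prop :=
  [/\ measurable_fun (unit_cube R r) W,
      forall x, unit_cube R r x -> 0 <= W x <= 1 &
      forall x (s : 'S_r), unit_cube R r x ->
        W [tuple tnth x (s i) | i < r] = W x].

(* A point of R^V is given by its coordinates along the enumeration of V. *)
Definition vertex_coord (V : finType) (x : #|V|.-tuple (measurableTypeR R))
    (v : V) : measurableTypeR R :=
  tnth x (enum_rank v).

(* The default value 0 is never used when #|e| = r; the order in which the
   vertices of e are listed is irrelevant when W is symmetric. *)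
Definition edge_tuple (V : finType) (x : #|V|.-tuple (measurableTypeR R))
    (e : {set V}) : r.-tuple (measurableTypeR R) :=
  [tuple nth 0 [seq vertex_coord x v | v <- enum e] i | i < r].

Definition hom_density (H : r_graph r)
    (W : r.-tuple (measurableTypeR R) -> R) : R :=
  \int[lebesgue_tuple R #|vertex H|]_(x in unit_cube R #|vertex H|)
    \prod_(e in edges H) W (edge_tuple x e).

Definition sidorenko (H : r_graph r) : Prop :=
  forall W : r.-tuple (measurableTypeR R) -> R, graphon W ->
  hom_density H W >=
    (\int[lebesgue_tuple R r]_(x in unit_cube R r) W x) ^+ #|edges H|.

End sidorenko.

(* Main.v *)
(* Put independent fair signs s_v on the coordinates, according to the half of
   [0, 1] containing them, and perturb the constant 1/2 to
   W = (1 - eps * I) / 2, where I(e) is the sum of s_u s_v over the ordered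
   pairs of distinct vertices of e.  Then W has mean 1/2, and
     2^e(H) t_H(W) = sum over F of (- eps)^|F| c_F,
   where F ranges over the sets of edges of H and c_F = E[prod_(e in F) I(e)].
   Expanding I, c_F is a sum of expectations of products of signs, each of them
   0 or 1, so c_F >= 0 and odd sets F never contribute positively.  In a linear
   hypergraph c_F = 0 when |F| = 2, since a pair of vertices lies in at most one
   edge, whereas c_F > 0 for a loose triangle: the pairs ab, bc, ca give the
   product 1.  So for small eps the sum is at most 1 - c eps^3 + O(eps^4) < 1. *)

Require Import Defs.
From mathcomp Require Import all_boot all_order all_algebra all_fingroup.
From mathcomp Require Import zify lra ring.
From mathcomp Require Import all_classical all_reals all_analysis measurable_realfun.

Set Implicit Arguments.
Unset Strict Implicit.
Unset Printing Implicit Defensive.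

Import Order.TTheory GRing.Theory Num.Theory.
Import numFieldNormedType.Exports.

Local Open Scope ring_scope.

Lemma prod_add1 (R : comNzRingType) (I : finType) (E : {set I}) (x : I -> R) :
  \prod_(i in E) (1 + x i) = \sum_(F : {set I} | F \subset E) \prod_(i in F) x i.
Proof.
(* Outside [E] the factor is written [0 + 1]: the expansion then runs over all subsets of [I], and
   those not inside [E] vanish. *)
rewrite big_mkcond /= (eq_bigr (fun i => (if i \in E then x i else 0) + 1)).
  2: by move=> i _; case: ifP => _; rewrite ?add0r // addrC.
rewrite bigA_distr [RHS]big_mkcond /=; apply: eq_bigr => F _.
rewrite -big_mkcond /=; case: ifPn => [/fintype.subsetP FE|].
  by apply: eq_bigr => i /FE ->.
by move=> /subsetPn[i iF iE]; rewrite (bigD1 i) //= (negbTE iE) mul0r.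
Qed.

(** * Sums over sign patterns and correlations of edges *)

Section spins.
Context (R : realDomainType) (V : finType).
Implicit Types (s t : {ffun V -> bool}) (e : {set V}) (F : {set {set V}}).

Definition xor_ffun s t : {ffun V -> bool} := [ffun v => s v (+) t v].

(* Multiplying the sum by M t permutes its terms. *)
Lemma sum_character_eq0 (M : {ffun V -> bool} -> R) t :
  (forall s u, M (xor_ffun s u) = M s * M u) -> M t != 1 -> \sum_s M s = 0.
Proof.
move=> hM Mt1; have xorK : involutive (xor_ffun^~ t).
  by move=> s; apply/ffunP => v; rewrite !ffunE addbK.
apply/eqP; have : (\sum_s M s) * (M t - 1) == 0.
  rewrite mulrBr mulr1 subr_eq0 mulr_suml; apply/eqP.
  rewrite [RHS](reindex_inj (inv_inj xorK)) /=.
  by apply: eq_bigr => s _; rewrite hM.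
by rewrite mulf_eq0 subr_eq0 (negbTE Mt1) orbF.
Qed.

(** Either [M] is constantly 1, or some [M t != 1] makes the sum vanish. *)
Lemma sum_character_ge0 (M : {ffun V -> bool} -> R) :
  (forall s u, M (xor_ffun s u) = M s * M u) -> 0 <= \sum_s M s.
Proof.
move=> hM; have [/forallP M1|/forallPn[t Mt]] := boolP [forall s, M s == 1].
  by apply: sumr_ge0 => s _; rewrite (eqP (M1 s)).
by rewrite (sum_character_eq0 hM Mt).
Qed.

Definition spin s v : R := (-1) ^+ s v.

Lemma spin_xor s t v : spin (xor_ffun s t) v = spin s v * spin t v.
Proof. by rewrite /spin ffunE signr_addb. Qed.

Lemma spin_sqr s v : spin s v * spin s v = 1.
Proof. by rewrite /spin -signr_addb addbb. Qed.

(** Shifting by [flip u] negates exactly the sign monomials of odd degree in [u]. *)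
Definition flip (u : V) : {ffun V -> bool} := [ffun v => v == u].

Lemma spin_flip u v : spin (flip u) v = if v == u then -1 else 1.
Proof. by rewrite /spin ffunE; case: eqP. Qed.

Definition distinct_pairs e : {set V * V} :=
  [set p | [&& p.1 \in e, p.2 \in e & p.1 != p.2]].

Definition interaction s e : R :=
  \sum_(p in distinct_pairs e) spin s p.1 * spin s p.2.

(** The diagonal pairs contribute [#|e|]. The square makes the interaction easy to bound and visibly
    independent of how [e] is listed. *)
Lemma sqr_sum_spin s e :
  (\sum_(v in e) spin s v) ^+ 2 = #|e|%:R + interaction s e.
Proof.
rewrite expr2 mulr_suml; under eq_bigr => u _ do rewrite mulr_sumr.
rewrite pair_big /= (bigID (fun p : V * V => p.1 == p.2)) /=; congr (_ + _).
  rewrite (reindex_onto (fun v : V => (v, v)) (fun p => p.1)) /=; last first.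
    by case=> u v /= /andP[_ /eqP ->].
  rewrite -sum1_card natr_sum; apply: eq_big => [v|v _]; last by rewrite spin_sqr.
  by rewrite !eqxx !andbT andbb.
by apply: eq_bigl => p; rewrite inE -andbA.
Qed.

Lemma sum_interaction e : \sum_s interaction s e = 0.
Proof.
rewrite exchange_big big1 //= => -[u v]; rewrite inE /= => /and3P[_ _ uv].
apply: (@sum_character_eq0 _ (flip u)) => [s t|].
  by rewrite !spin_xor mulrACA.
by rewrite !spin_flip eqxx (eq_sym v) (negbTE uv) mulr1 lt_eqF //
  (lt_trans ltrN10).
Qed.

(** This is $2^{|V|} c_F$: the average over signs is left unnormalised. *)
Definition correlation F : R := \sum_s \prod_(e in F) interaction s e.

(** One monomial of the expanded product of interactions, where [f] picks a pair in each edge. *)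
Definition chosen_pairs (f : {set V} -> V * V) F s : R :=
  \prod_(e in F) (spin s (f e).1 * spin s (f e).2).

Lemma chosen_pairs_xor f F s t :
  chosen_pairs f F (xor_ffun s t) = chosen_pairs f F s * chosen_pairs f F t.
Proof.
rewrite /chosen_pairs -big_split; apply: eq_bigr => e _ /=.
by rewrite !spin_xor mulrACA.
Qed.

(** The value [(v0, v0)] is imposed on [f] outside [F], so that each choice of pairs is counted
    once. *)
Lemma correlationE (v0 : V) F : correlation F =
  \sum_(f in pfamily (v0, v0) (mem F) distinct_pairs) \sum_s chosen_pairs f F s.
Proof.
rewrite exchange_big; apply: eq_bigr => s _ /=.
by rewrite (big_distr_big_dep (v0, v0)).
Qed.

Lemma sum_chosen_pairs_ge0 f F : 0 <= \sum_s chosen_pairs f F s.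
Proof. by apply: sum_character_ge0 => s t; exact: chosen_pairs_xor. Qed.

Lemma correlation_ge0 F : 0 <= correlation F.
Proof.
(* The default pair in [correlationE] requires a vertex; without vertices all interactions are empty
   sums. *)
have [v0 _|V0] := pickP (@predT V).
  by rewrite (correlationE v0); apply: sumr_ge0 => f _; exact: sum_chosen_pairs_ge0.
apply: sumr_ge0 => s _; apply: prodr_ge0 => e _; apply: sumr_ge0 => p _.
by have := V0 p.1.
Qed.

(* Two edges carry equal pairs only if they share two vertices, so some vertex
   occurs exactly once in the product of the chosen pairs. *)
Lemma correlation2_eq0 e1 e2 :
  e1 != e2 -> (#|e1 :&: e2| <= 1)%N -> correlation [set e1; e2] = 0.
Proof.
move=> e12 c12; rewrite /correlation.
have [v0 _|V0] := pickP (@predT V); last first.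
  apply: big1 => s _; rewrite big_setU1 ?inE //= /interaction.
  by rewrite big1 ?mul0r // => p _; have := V0 p.1.
rewrite -/(correlation _) (correlationE v0); apply: big1 => f /pfamilyP[_ hf].
have := hf e1 (set21 _ _); have := hf e2 (set22 _ _).
rewrite !inE; case Ef2 : (f e2) => [u2 v2]; case Ef1 : (f e1) => [u1 v1] /=.
move=> /and3P[u2e v2e uv2] /and3P[u1e v1e uv1].
have [w hw] : exists w, chosen_pairs f [set e1; e2] (flip w) = -1.
  rewrite /chosen_pairs.
  have [w1|w1] := boolP (u1 \in [set u2; v2]); last first.
    exists u1; rewrite big_setU1 ?inE //= big_set1 Ef1 Ef2 /= !spin_flip.
    move: w1; rewrite !inE negb_or ![u1 == _]eq_sym => /andP[/negbTE -> /negbTE ->].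
    by rewrite eqxx (eq_sym v1) (negbTE uv1) !mulr1.
  have [w2|w2] := boolP (v1 \in [set u2; v2]); last first.
    exists v1; rewrite big_setU1 ?inE //= big_set1 Ef1 Ef2 /= !spin_flip.
    move: w2; rewrite !inE negb_or ![v1 == _]eq_sym => /andP[/negbTE -> /negbTE ->].
    by rewrite eqxx (negbTE uv1) !mulr1 mul1r.
  have sub : [set u2; v2] \subset e2 by rewrite finset.subUset !finset.sub1set u2e.
  have : [set u1; v1] \subset e1 :&: e2.
    by rewrite finset.subUset !finset.sub1set !inE u1e v1e !(fintype.subsetP sub).
  by move=> /subset_leq_card; rewrite cards2 uv1 leqNgt ltnS c12.
apply: (@sum_character_eq0 _ (flip w)) => [s t|]; first exact: chosen_pairs_xor.
by rewrite hw lt_eqF // (lt_trans ltrN10).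
Qed.

(** The choice ab, bc, ca squares each of the three signs and so contributes a sum of ones; every
    other choice contributes at least 0. *)
Lemma correlation_triangle_gt0 a b c e1 e2 e3 :
  a != b -> b != c -> c != a ->
  a \in e1 -> b \in e1 -> b \in e2 -> c \in e2 -> c \in e3 -> a \in e3 ->
  e1 != e2 -> e1 != e3 -> e2 != e3 ->
  0 < correlation [set e1; e2; e3].
Proof.
move=> ab bc ca a1 b1 b2 c2 c3 a3 e12 e13 e23.
pose f : {ffun {set V} -> V * V} := [ffun e => if e == e1 then (a, b) else
  if e == e2 then (b, c) else if e == e3 then (c, a) else (a, a)].
have f1 : f e1 = (a, b) by rewrite ffunE eqxx.
have f2 : f e2 = (b, c) by rewrite ffunE eq_sym (negbTE e12) eqxx.
have f3 : f e3 = (c, a).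
  by rewrite ffunE ![e3 == _]eq_sym (negbTE e13) (negbTE e23) eqxx.
rewrite (correlationE a) (bigD1 f) /=; last first.
  apply/pfamilyP; split.
    apply/fintype.subsetP => e; rewrite !inE ffunE.
    by case: (e == e1) => //; case: (e == e2) => //; case: (e == e3); rewrite ?eqxx.
  by move=> e; rewrite !inE -orbA => /or3P[] /eqP ->;
    rewrite (f1, f2, f3) /=; apply/and3P.
apply: ltr_wpDr; first by apply: sumr_ge0 => g _; exact: sum_chosen_pairs_ge0.
rewrite (eq_bigr (fun=> 1)) => [|s _].
  by rewrite sumr_const ltr0n card_ffun expn_gt0 card_bool.
rewrite /chosen_pairs (big_setD1 e3) ?inE ?eqxx ?orbT //=.
rewrite (_ : _ :\ e3 = [set e1; e2]); last first.
  apply/setP => e; rewrite !inE; have [->|_] := eqVneq e e3; last by rewrite /= orbF.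
  by rewrite /= ![e3 == _]eq_sym (negbTE e13) (negbTE e23).
rewrite big_setU1 ?inE //= big_set1 f1 f2 f3 /=.
by ring: (spin_sqr s a) (spin_sqr s b) (spin_sqr s c).
Qed.

End spins.

(** * Integrating functions of the halves of the coordinates *)

Section cube_integral.
Context (R : realType).

(** The midpoint goes to the upper half, as in [coin], so that the boxes partition the cube. *)
Let half_itv (b : bool) : interval R :=
  if b then `[(1 / 2 : R), 1] else `[(0 : R), 1 / 2[.

Let lebesgue_half b : lebesgue_measure ([set` half_itv b]%classic : set R) = (1 / 2)%:E.
Proof.
have h0 : (0 : R) < 1 / 2 by lra.
have h1 : 1 / 2 < (1 : R) by lra.
by case: b; rewrite /half_itv lebesgue_measure_itv /= lte_fin ?h0 ?h1 -EFinD;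
  congr EFin; lra.
Qed.

Definition coin n (x : n.-tuple (measurableTypeR R)) : {ffun 'I_n -> bool} :=
  [ffun i => (1 / 2 : R) <= tnth x i].

Let box n (s : {ffun 'I_n -> bool}) : set (n.-tuple (measurableTypeR R)) :=
  [set x | forall i, [set` half_itv (s i)]%classic (tnth x i)]%classic.

Let boxE n s (x : n.-tuple (measurableTypeR R)) :
  box s x <-> unit_cube R n x /\ coin x = s.
Proof.
split.
  move=> xs; split.
    move=> i; have := xs i; rewrite /half_itv.
    by case: (s i); rewrite /= in_itv /= => /andP[]; lra.
  apply/ffunP => i; have := xs i; rewrite ffunE /half_itv.
  case: (s i); rewrite /= in_itv /= => /andP[]; first by [].
  by move=> _; rewrite ltNge => /negbTE.
case=> x01 <- i; have := x01 i; rewrite ffunE /half_itv.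
by case: (leP (1 / 2 : R)) => [h|h] /andP[h0 h1]; rewrite /= in_itv /= ?h ?h0.
Qed.

Let measurable_box n (s : {ffun 'I_n -> bool}) : measurable (box s).
Proof.
by case: (@lebesgue_tuple_box R n (fun i => [set` half_itv (s i)]%classic)
  (fun=> measurable_itv _)).
Qed.

Let lebesgue_box n (s : {ffun 'I_n -> bool}) :
  lebesgue_tuple R n (box s) = ((1 / 2) ^+ n)%:E.
Proof.
have [_] := @lebesgue_tuple_box R n (fun i => [set` half_itv (s i)]%classic)
  (fun=> measurable_itv _).
rewrite -/(box s) => ->; rewrite (eq_bigr (fun=> (1 / 2)%:E)) => [|i _].
  by rewrite prodEFin prodr_const card_ord.
exact: lebesgue_half.
Qed.

(** The integrand is a step function on $2^n$ boxes, each of measure $2^{-n}$. *)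
Lemma Rintegral_coin n (g : {ffun 'I_n -> bool} -> R) :
  \int[lebesgue_tuple R n]_(x in unit_cube R n) g (coin x) =
  (1 / 2) ^+ n * \sum_s g s.
Proof.
have mC := @measurable_unit_cube R n.
rewrite /Rintegral.
have step x : unit_cube R n x ->
    (g (coin x))%:E = (\sum_s (g s * \1_(box s) x)%:E)%E.
  move=> x01; rewrite sumEFin (bigD1 (coin x)) //= indicE mem_set ?boxE //.
  rewrite mulr1 big1 ?addr0 // => s sx; rewrite indicE memNset ?mulr0 //.
  by rewrite boxE => -[_ /esym/eqP]; rewrite (negbTE sx).
have boxC s : (box s `&` unit_cube R n)%classic = box s.
  by apply/setIidl => x /boxE[].
have intb s : (\int[lebesgue_tuple R n]_(x in unit_cube R n)
    (\1_(box s) x)%:E = ((1 / 2) ^+ n)%:E)%E.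
  rewrite integral_indic //; last exact: measurable_box.
  by have -> : (box s `&` unit_cube R n)%classic = box s := boxC s; exact: lebesgue_box.
have int1 s : (lebesgue_tuple R n).-integrable (unit_cube R n)
    (EFin \o (\1_(box s) : _ -> R)).
  apply/integrableP; split.
    apply/measurable_EFinP.
    exact: (@measurable_indic _ _ R _ _ (measurable_box s)).
  under eq_integral => x _ do rewrite /= ger0_norm //.
  by rewrite intb ltry.
under eq_integral => x /set_mem x01 do rewrite step //.
rewrite integral_sum // => [|s].
  rewrite (eq_bigr (fun s => (g s * (1 / 2) ^+ n)%:E)) => [|s _].
    by rewrite sumEFin /= -mulr_suml mulrC.
  under eq_integral => x _ do rewrite EFinM.
  by rewrite (integralZl mC (int1 s)) intb.
under eq_fun => x do rewrite EFinM.
exact: (integrableZl mC (g s) (int1 s)).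
Qed.

End cube_integral.

(** * Expansion in powers of [eps] *)

Section perturbation.
Context (R : realDomainType) (V : finType) (E : {set {set V}}).
Context (E_linear : forall e f : {set V}, e \in E -> f \in E -> e != f ->
  (#|e :&: f| <= 1)%N).

Lemma sum_prod_interaction (eps : R) :
  \sum_s \prod_(e in E) (1 - eps * interaction R s e) =
  \sum_(F : {set {set V}} | F \subset E) (- eps) ^+ #|F| * correlation R F.
Proof.
under eq_bigr => s _ do under eq_bigr => e _ do rewrite -mulNr.
under eq_bigr => s _ do rewrite prod_add1.
rewrite exchange_big; apply: eq_bigr => F _ /=.
by rewrite mulr_sumr; apply: eq_bigr => s _; rewrite big_split prodr_const.
Qed.

(** Odd sets give a nonpositive left side, pairs of edges have zero correlation by linearity, and
    the remaining even sets have at least 4 edges. *)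
Lemma correlation_term_le (eps : R) (F : {set {set V}}) :
  0 <= eps <= 1 -> F \subset E -> F != finset.set0 ->
  (- eps) ^+ #|F| * correlation R F <= eps ^+ 4 * correlation R F.
Proof.
move=> /andP[eps0 eps1] FE F0; have cF := correlation_ge0 R F.
have [oddF|evenF] := boolP (odd #|F|).
  rewrite ler_wpM2r // exprNn -signr_odd oddF mulN1r.
  by rewrite (le_trans (y := 0)) ?exprn_ge0 // oppr_le0 exprn_ge0.
rewrite exprNn -signr_odd (negbTE evenF) mul1r.
have [F2|F2] := eqVneq #|F| 2.
  have /cards2P[e1 [e2 [e12 FE12]]] : #|F| == 2 by rewrite F2.
  have [e1E e2E] : e1 \in E /\ e2 \in E.
    by split; apply: (fintype.subsetP FE); rewrite FE12 !inE eqxx ?orbT.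
  by rewrite FE12 correlation2_eq0 ?mulr0 //; exact: E_linear.
rewrite ler_wpM2r // ler_wiXn2l //.
by move: F0 F2 evenF; rewrite -cards_eq0; case: #|F| => [|[|[|[|?]]]].
Qed.

(** The empty set gives [2 ^+ #|V|] and [F0] a loss of order [eps ^+ 3], which outweighs the
    fourth-order bound on all other terms. *)
Lemma sum_prod_interaction_lt (eps : R) (F0 : {set {set V}}) :
  0 < eps <= 1 -> F0 \subset E -> #|F0| = 3 ->
  eps * (\sum_(F : {set {set V}} | F \subset E) correlation R F) <
    correlation R F0 ->
  \sum_s \prod_(e in E) (1 - eps * interaction R s e) < 2 ^+ #|V|.
Proof.
move=> /andP[eps0 eps1] F0E F03 small.
have epsI : 0 <= eps <= 1 by rewrite ltW.
have F0n0 : F0 != finset.set0 by rewrite -cards_eq0 F03.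
rewrite sum_prod_interaction (bigD1 finset.set0) ?finset.sub0set //=.
rewrite cards0 expr0 mul1r (_ : correlation R finset.set0 = 2 ^+ #|V|); last first.
  rewrite /correlation (eq_bigr (fun=> 1)) => [|s _]; last by rewrite big_set0.
  by rewrite sumr_const card_ffun card_bool natrX.
rewrite gtrDl (bigD1 F0) /= ?F0E // F03.
set S := \sum_(_ | _) _.
have : S <= eps ^+ 4 * \sum_(F : {set {set V}} | F \subset E) correlation R F.
  (* The right side also has terms for the empty set and [F0]; they are nonnegative. *)
  rewrite mulr_sumr [leRHS](bigID (fun F => (F != finset.set0) && (F != F0))) /=.
  rewrite -[leLHS]addr0 lerD //.
    rewrite [leRHS](eq_bigl _ _ (fun F => andbA _ _ _)).
    by apply: ler_sum => F /andP[/andP[FE Fn0] _]; exact: correlation_term_le.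
  apply: sumr_ge0 => F _.
  by rewrite mulr_ge0 ?correlation_ge0 ?exprn_ge0 ?ltW.
move=> SC; rewrite (_ : (- eps) ^+ 3 * _ = - (eps ^+ 3 * correlation R F0)).
  2: by rewrite exprNn -signr_odd mulN1r mulNr.
rewrite addrC subr_lt0 (le_lt_trans SC) //.
by rewrite exprSr -mulrA ltr_pM2l ?exprn_gt0.
Qed.

End perturbation.

(** * The perturbed graphon and its densities *)

Section spin_graphon.
Context (R : realType) (r : nat).

Definition spin_graphon (eps : R) (y : r.-tuple (measurableTypeR R)) : R :=
  (1 - eps * interaction R (coin y) [set: 'I_r]) / 2.

Lemma interaction_coinE (y : r.-tuple (measurableTypeR R)) :
  interaction R (coin y) [set: 'I_r] =
  (\sum_i (-1) ^+ ((1 / 2 : R) <= tnth y i)%R) ^+ 2 - r%:R.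
Proof.
have := sqr_sum_spin R (coin y) [set: 'I_r].
rewrite cardsT card_ord => /eqP; rewrite addrC -subr_eq => /eqP <-.
congr (_ ^+ 2 - _); apply: eq_big => [i|i _]; first by rewrite inE.
by rewrite /spin ffunE.
Qed.

Lemma graphon_spin_graphon (eps : R) :
  0 <= eps -> eps * (r ^ 2)%:R <= 1 -> graphon (spin_graphon eps).
Proof.
move=> eps0 epsr; split.
- apply: measurable_funTS; apply: measurable_funM; last exact: measurable_cst.
  apply: measurable_funB; first exact: measurable_cst.
  apply: measurable_funM; first exact: measurable_cst.
  rewrite (_ : (fun _ => _) = (fun y : r.-tuple (measurableTypeR R) =>
    (\sum_i (if (1 / 2 : R) <= tnth y i then -1 else 1 : R)) ^+ 2 - r%:R)).
    apply: measurable_funB; last exact: measurable_cst.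
    apply: measurable_funX; apply: measurable_sum => i.
    apply: measurable_fun_ifT; [|exact: measurable_cst|exact: measurable_cst].
    apply: measurable_fun_ler; first exact: measurable_cst.
    exact: measurable_tnth.
  apply/funext => y; rewrite interaction_coinE; congr (_ ^+ 2 - _).
  by apply: eq_bigr => i _; case: ifP => _; rewrite (expr0, expr1).
- move=> y _; rewrite /spin_graphon interaction_coinE.
  set S := \sum_i _.
  (* Hence the interaction lies between [- r] and [r ^ 2 - r], and [eps] times it between -1 and
     1. *)
  have S2 : 0 <= S ^+ 2 <= (r ^ 2)%:R.
    rewrite sqr_ge0 /= natrX -real_normK ?num_real //.
    rewrite ler_sqr ?nnegrE // (le_trans (ler_norm_sum _ _ _)) //.
    by under eq_bigr => i _ do rewrite normr_sign; rewrite sumr_const card_ord.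
  have rr2 : (r%:R : R) <= (r ^ 2)%:R by rewrite ler_nat; nia.
  have r0 : 0 <= (r%:R : R) by [].
  have [S0 Sr] := andP S2.
  have := ler_wpM2l eps0 Sr; have := mulr_ge0 eps0 S0.
  have := ler_wpM2l eps0 rr2; have := mulr_ge0 eps0 r0.
  by move: epsr; rewrite mulrBr; move=> *; apply/andP; split; lra.
- move=> y s _; rewrite /spin_graphon !interaction_coinE.
  congr ((1 - eps * (_ ^+ 2 - _)) / 2).
  rewrite [RHS](reindex_inj (@perm_inj _ s)) /=.
  by apply: eq_bigr => i _; rewrite tnth_mktuple.
Qed.

Lemma Rintegral_spin_graphon (eps : R) :
  \int[lebesgue_tuple R r]_(x in unit_cube R r) spin_graphon eps x = 1 / 2.
Proof.
rewrite (Rintegral_coin (fun s => (1 - eps * interaction R s [set: 'I_r]) / 2)).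
rewrite -mulr_suml sumrB -mulr_sumr sum_interaction mulr0 subr0.
rewrite sumr_const card_ffun card_bool card_ord natrX mulrA -exprMn.
by rewrite div1r mulVf ?pnatr_eq0 // expr1n div1r.
Qed.

Lemma spin_graphon_edge (eps : R) (V : finType)
    (x : #|V|.-tuple (measurableTypeR R)) (e : {set V}) : #|e| = r ->
  spin_graphon eps (edge_tuple r x e) =
  (1 - eps * interaction R [ffun v => coin x (enum_rank v)] e) / 2.
Proof.
move=> er; rewrite /spin_graphon interaction_coinE.
congr ((1 - eps * _) / 2).
have := sqr_sum_spin R [ffun v => coin x (enum_rank v)] e.
rewrite er => /eqP; rewrite addrC -subr_eq => /eqP <-; congr (_ ^+ 2 - _).
pose g (t : measurableTypeR R) : R := (-1) ^+ ((1 / 2 : R) <= t)%R.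
(* The sum of signs over the listed coordinates can be reindexed by the vertices of [e], whatever
   their order. *)
transitivity (\sum_(t <- [seq vertex_coord x v | v <- enum e]) g t).
  rewrite (big_nth 0) size_map -cardE er big_mkord.
  by apply: eq_bigr => i _; rewrite tnth_mktuple.
rewrite big_map big_enum /=; apply: eq_bigr => v _.
by rewrite /spin !ffunE.
Qed.

Lemma hom_density_spin_graphon (eps : R) (H : r_graph r) :
  hom_density H (spin_graphon eps) =
  (1 / 2) ^+ #|edges H| * ((1 / 2) ^+ #|vertex H| *
    \sum_s \prod_(e in edges H) (1 - eps * interaction R s e)).
Proof.
(* Integration produces signs on enumeration indices, correlations use signs on vertices; [rank] and
   [unrank] translate. *)
pose rank (s : {ffun 'I_#|vertex H| -> bool}) : {ffun vertex H -> bool} :=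
  [ffun v => s (enum_rank v)].
pose unrank (s : {ffun vertex H -> bool}) : {ffun 'I_#|vertex H| -> bool} :=
  [ffun i => s (enum_val i)].
pose g s := \prod_(e in edges H) ((1 - eps * interaction R (rank s) e) / 2).
rewrite /hom_density; transitivity
  (\int[lebesgue_tuple R #|vertex H|]_(x in unit_cube R #|vertex H|) g (coin x)).
  apply: eq_Rintegral => x _; apply: eq_bigr => e eH.
  by rewrite spin_graphon_edge //; exact: edges_uniform eH.
rewrite Rintegral_coin mulrCA; congr (_ * _); rewrite mulr_sumr.
rewrite (reindex unrank) /=; last first.
  by exists rank => s _; apply/ffunP => i; rewrite !ffunE (enum_rankK, enum_valK).
apply: eq_bigr => s _; rewrite /g big_split /= prodr_const mulrC div1r.
congr (_ * _); apply: eq_bigr => e _; congr (1 - eps * interaction R _ _).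
by apply/ffunP => v; rewrite !ffunE enum_rankK.
Qed.

End spin_graphon.

(** * The triangle inside the hypergraph and the choice of [eps] *)

Lemma contains_loose_triangle r (r2 : (2 <= r)%N) (H : r_graph r) :
  contains H (loose_triangle r2) ->
  exists a b c : vertex H, exists e1 e2 e3 : {set vertex H},
  [/\ [/\ a != b, b != c & c != a],
      [/\ a \in e1, b \in e1, b \in e2, c \in e2 & c \in e3 /\ a \in e3],
      [/\ e1 \in edges H, e2 \in edges H & e3 \in edges H] &
      [/\ e1 != e2, e1 != e3 & e2 != e3]].
Proof.
move=> [f [finj fE]].
have la : (0 < 3 * r - 3)%N by lia.
have lb : (r - 1 < 3 * r - 3)%N by lia.
have lc : (2 * r - 2 < 3 * r - 3)%N by lia.
(* The vertices 1, r and 2r - 1 shared by consecutive edges, shifted down by one. *)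
pose a := Ordinal la; pose b := Ordinal lb; pose c := Ordinal lc.
pose e1 := [set i : 'I_(3 * r - 3) | (i.+1 <= r)%N]%SET.
pose e2 := 
  [set i : 'I_(3 * r - 3) | (r <= i.+1 <= 2 * r - 1)%N]%SET.
pose e3 :=
  [set i : 'I_(3 * r - 3) | (2 * r - 1 <= i.+1)%N || (i.+1 == 1)%N]%SET.
have [a1 b1 c1] : [/\ a \in e1, b \in e1 & c \notin e1].
  by split; rewrite inE /=; lia.
have [a2 b2 c2] : [/\ a \notin e2, b \in e2 & c \in e2].
  by split; rewrite inE /=; lia.
have [a3 b3 c3] : [/\ a \in e3, b \notin e3 & c \in e3].
  by split; rewrite inE /=; lia.
exists (f a), (f b), (f c), (f @: e1), (f @: e2), (f @: e3); split.
- by split; rewrite (inj_eq finj) -val_eqE /=; lia.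
- by split; [..|split]; exact: imset_f.
- by split; apply: fE; rewrite !inE eqxx ?orbT.
- split; rewrite (inj_eq (imset_inj finj)).
  + by apply: contraNneq a2 => <-.
  + by apply: contraNneq b3 => <-.
  + by apply: contraNneq a2 => ->.
Qed.

Theorem theorem1p3 (R : realType) (r : nat) (r2 : (2 <= r)%N) (H : r_graph r)
    (Hlin : linear_r_graph H) (Htri : contains H (loose_triangle r2)) :
  ~ sidorenko R H.
Proof.
have [a [b [c [e1 [e2 [e3 [[ab bc ca] [a1 b1 b2 c2 [c3 a3]] [E1 E2 E3]
  [e12 e13 e23]]]]]]]] := contains_loose_triangle Htri.
pose F0 := [set e1; e2; e3]%SET.
have c0 : 0 < correlation R F0.
  exact: (correlation_triangle_gt0 R ab bc ca a1 b1 b2 c2 c3 a3 e12 e13 e23).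
pose C := \sum_(F : {set {set vertex H}} | F \subset edges H) correlation R F.
have C0 : 0 <= C by apply: sumr_ge0 => F _; exact: correlation_ge0.
(* The first bound keeps the graphon within [0, 1]; in the second, [C + 1] instead of [C] gives the
   strict inequality [epsC]. *)
pose eps : R := Num.min (r ^ 2)%:R^-1 (correlation R F0 / (C + 1)).
have r20 : (0 : R) < (r ^ 2)%:R by rewrite ltr0n expn_gt0 (leq_trans _ r2).
have C10 : 0 < C + 1 by rewrite ltr_wpDl.
have eps0 : 0 < eps by rewrite lt_min invr_gt0 r20 divr_gt0.
have epsr : eps * (r ^ 2)%:R <= 1.
  by rewrite -ler_pdivlMr // div1r ge_min lexx.
have epsC : eps * C < correlation R F0.
  apply: lt_le_trans (_ : eps * (C + 1) <= _); first by rewrite ltr_pM2l ?ltrDl.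
  by rewrite -ler_pdivlMr // ge_min lexx orbT.
have eps1 : 0 < eps <= 1.
  rewrite eps0 (le_trans _ epsr) // ler_peMr ?(ltW eps0) // ler1n expn_gt0.
  by rewrite (leq_trans _ r2).
have F0E : F0 \subset edges H.
  by apply/fintype.subsetP => e; rewrite !inE -orbA => /or3P[] /eqP ->.
have F03 : #|F0| = 3.
  rewrite /F0 finset.setUC cardsU1 cards2 e12 !inE ![e3 == _]eq_sym.
  by rewrite (negbTE e13) (negbTE e23).
have lt := sum_prod_interaction_lt Hlin eps1 F0E F03 epsC.
move=> /(_ _ (graphon_spin_graphon (ltW eps0) epsr)).
rewrite hom_density_spin_graphon Rintegral_spin_graphon leNgt => /negP; apply.
(* Cancelling one factor 1/2 per edge leaves the claim that the average over sign patterns is below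
   1. *)
rewrite gtr_pMr ?exprn_gt0 //.
rewrite div1r exprVn mulrC ltr_pdivrMr ?exprn_gt0 // mul1r.
exact: lt.
Qed.
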